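(* Let $X$ be a path-connected, locally path connected space, $x_0\in X$, and $H\leq\pi_1(X,x_0)$. Suppose that $X$ is an $H$-SLT space and that $H$ is locally quasinormal. Let $\alpha\in P(X,x_0)$ with $\alpha(1)=x$. Then $H_\alpha$ is closed in $\pi_1^{qtop}(X,x)$ if and only if $H_\alpha$ is closed in $\pi_1^{wh}(X,x)$.
   Context: For a point $y\in X$, $P(X,y)$ denotes the set of paths $[0,1]\to X$ starting at $y$; $[\cdot]$ denotes path-homotopy class rel endpoints, $\ast$ is concatenation, and $\bar\alpha$ is the reverse of $\alpha$. For an open set $U\ni y$, $i_\#\pi_1(U,y)\leq\pi_1(X,y)$ is the image of $\pi_1(U,y)$ under the inclusion. For $\alpha\in P(X,y)$ and an open set $V\ni\alpha(1)$, put $\pi(\alpha,V)=\{[\alpha\ast\delta\ast\bar\alpha] : \delta \text{ a loop in } V \text{ based at } \alpha(1)\}\leq\pi_1(X,y)$. For $H\le\pi_1(X,x_0)$ and $\alpha\in P(X,x_0)$, $H_\alpha=\{[\bar\alpha\ast\delta\ast\alpha] : [\delta]\in H\}\leq\pi_1(X,\alpha(1))$. A subgroup $K\le\pi_1(X,y)$ is locally quasinormal if for every $\gamma\in P(X,y)$ and every open $U\ni\gamma(1)$ there is an open $V$ with $\gamma(1)\in V\subseteq U$ and $K\pi(\gamma,V)=\pi(\gamma,V)K$ (equality of product sets). For $K\le\pi_1(X,y)$, $X$ is $K$-SLT (a $K$-small loop transfer space) at $y$ if for every $\gamma\in P(X,y)$ and every open $U\ni y$ there is an open $V\ni\gamma(1)$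 with $\pi(\gamma,V)\subseteq K\, i_\#\pi_1(U,y)$. For $H\le\pi_1(X,x_0)$, $X$ is an $H$-SLT space if for every $\delta\in P(X,x_0)$, $X$ is $H_\delta$-SLT at $\delta(1)$. Topologies on $\pi_1(X,x)$: let $\widetilde X$ be the set of path-homotopy classes (rel endpoints) of paths in $P(X,x)$; it contains $\pi_1(X,x)$. $\pi_1^{qtop}(X,x)$ is $\pi_1(X,x)$ with the subspace topology from $\widetilde X$ when $\widetilde X$ carries the quotient topology from $P(X,x)$ with the compact-open topology. $\pi_1^{wh}(X,x)$ is $\pi_1(X,x)$ with the subspace topology from $\widetilde X$ when $\widetilde X$ carries the whisker topology, which has as basis the sets $N([\gamma],U)=\{[\gamma\ast\delta] : \delta \text{ a path in } U,\ \delta(0)=\gamma(1)\}$, with $[\gamma]\in\widetilde X$ and $U$ an open neighborhood of $\gamma(1)$. *)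

(* Defs.v *)
From HB Require Import structures.
From mathcomp Require Import all_boot all_order all_algebra generic_quotient.
From mathcomp Require Import lra.
From mathcomp Require Import mathcomp_extra boolp classical_sets functions.
From mathcomp Require Import set_interval reals topology normedtype homotopy.
Import numFieldNormedType.Exports.

Set Implicit Arguments.
Unset Strict Implicit.
Unset Printing Implicit Defensive.

Import Order.TTheory GRing.Theory Num.Theory.

Local Open Scope classical_set_scope.
Local Open Scope ring_scope.
Local Open Scope quotient_scope.

Section unit_interval.
Variable R : realType.

Definition unit_interval : Type := set_type `[(0 : R), 1]%classic.

HB.instance Definition _ :=
  Topological.copy unit_interval (set_type `[(0 : R), 1]%classic).

Definition uval (t : unit_interval) : R := set_val t.

Lemma clamp_subproof (a : R) :
  Num.max 0 (Num.min 1 a) \in `[(0 : R), 1]%classic.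
Proof.
apply/mem_set; rewrite /= in_itv /= le_max lexx /=.
by rewrite ge_max ler01 ge_min lexx.
Qed.

(* The retraction of the line onto [0, 1]; [clamp a] is [a] on [0, 1]. *)
Definition clamp (a : R) : unit_interval :=
  exist (fun b : R => b \in `[(0 : R), 1]%classic) _ (clamp_subproof a).

Lemma uval_itv t : 0 <= uval t <= 1.
Proof. by case: t => a Ha; move: (set_mem Ha); rewrite /= in_itv. Qed.

Lemma uval_inj : injective uval.
Proof. exact: val_inj. Qed.

Lemma uval_clamp a : uval (clamp a) = Num.max 0 (Num.min 1 a).
Proof. by []. Qed.

Lemma clampK a : 0 <= a <= 1 -> uval (clamp a) = a.
Proof.
move=> /andP[a0 a1]; rewrite uval_clamp.
by rewrite (min_r a1) (max_r a0).
Qed.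

Lemma uvalK t : clamp (uval t) = t.
Proof. by apply: uval_inj; rewrite clampK// uval_itv. Qed.

Lemma uval_continuous : continuous uval.
Proof. exact: initial_continuous. Qed.

Lemma clamp_continuous : continuous clamp.
Proof.
apply: continuous_comp_initial => a /=.
apply: (@continuous_max R R (cst 0) (fun a => Num.min 1 a)); first exact: cvg_cst.
apply: (@continuous_min R R (cst 1) id); [exact: cvg_cst|exact: cvg_id].
Qed.

Lemma unit_interval_zero_one : clamp 0 != clamp 1.
Proof.
apply/eqP => /(congr1 uval); rewrite !clampK ?lexx ?ler01//.
by move/eqP; rewrite eq_sym oner_eq0.
Qed.

HB.instance Definition _ := isBiPointed.Build unit_interval
  unit_interval_zero_one.

Lemma uval0 : uval zero = 0.
Proof. by rewrite clampK// lexx ler01. Qed.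

Lemma uval1 : uval one = 1.
Proof. by rewrite clampK// lexx ler01. Qed.

End unit_interval.

Section continuity.

Lemma pair_continuous (A B C : topologicalType) (u : A -> B) (v : A -> C) :
  continuous u -> continuous v -> continuous (fun a => (u a, v a)).
Proof. by move=> cu cv a; apply: cvg_pair; [exact: cu|exact: cv]. Qed.

Lemma comp_continuous (A B C : topologicalType) (u : A -> B) (v : B -> C) :
  continuous u -> continuous v -> continuous (fun a => v (u a)).
Proof. by move=> cu cv a; apply: continuous_comp; [exact: cu|exact: cv]. Qed.

Lemma fst_continuous (A B : topologicalType) : continuous (@fst A B).
Proof. by move=> a; exact: cvg_fst. Qed.

Lemma snd_continuous (A B : topologicalType) : continuous (@snd A B).
Proof. by move=> a; exact: cvg_snd. Qed.

End continuity.

Section paths.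
Context {R : realType} {X : topologicalType}.
Local Notation UI := (unit_interval R).
Implicit Types (f g h : UI -> X) (t s : UI).

(* [f] and [g] are run at double speed; this is meaningful only when
   [f one = g zero], as otherwise the point 1/2 is a discontinuity. *)
Definition concat f g t : X :=
  if uval t <= 2^-1 then f (clamp (2 * uval t))
  else g (clamp (2 * uval t - 1)).

Definition reverse f t : X := f (clamp (1 - uval t)).

(* Stated on bare functions so that it also compares paths whose endpoints are
   equal without being the same term; it implies [f one = g one]. *)
Definition path_homotopic f g := exists F : UI * UI -> X,
  [/\ continuous F,
      forall t, F (t, zero) = f t, forall t, F (t, one) = g t,
      forall s, F (zero, s) = f zero & forall s, F (one, s) = f one].

Lemma glue_continuous (A : topologicalType) (c : A -> R) (u v : A -> X) :
  continuous c -> continuous u -> continuous v ->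
  (forall a, c a = 2^-1 -> u a = v a) ->
  continuous (fun a => if c a <= 2^-1 then u a else v a).
Proof.
move=> cc cu cv uv; apply/continuous_subspace_setT.
have -> : [set: A] = (c @^-1` [set r | r <= 2^-1]) `|` (c @^-1` [set r | 2^-1 <= r]).
  by rewrite eqEsubset; split=> // a _; have /orP := le_total (c a) 2^-1.
apply: withinU_continuous.
- by apply: preimage_closed; [move=> ? _; exact: cc|exact: closed_le].
- by apply: preimage_closed; [move=> ? _; exact: cc|exact: closed_ge].
- apply: (@subspace_eq_continuous _ _ _ u); last exact: continuous_subspaceT.
  by move=> a; rewrite inE => ca; rewrite /from_subspace ifT.

- apply: (@subspace_eq_continuous _ _ _ v); last exact: continuous_subspaceT.
  move=> a; rewrite inE => /= ca; rewrite /from_subspace; case: ifP => // ca'.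
  by rewrite uv//; apply/eqP; rewrite eq_le ca' ca.
Qed.

Lemma affine_continuous (A : topologicalType) (c : A -> R) (k b : R) :
  continuous c -> continuous (fun a => clamp (k * c a + b)).
Proof.
move=> cc; apply: comp_continuous; last exact: clamp_continuous.
by move=> a; apply: cvgD; [apply: cvgMr; exact: cc|exact: cvg_cst].
Qed.

Lemma clamp_le0 (a : R) : a <= 0 -> clamp a = zero.
Proof.
move=> a0; apply: uval_inj; rewrite uval0 uval_clamp.
by rewrite (min_r (le_trans a0 ler01)) (max_l a0).
Qed.

Lemma clamp_ge1 (a : R) : 1 <= a -> clamp a = one.
Proof.
move=> a1; apply: uval_inj; rewrite uval1 uval_clamp.
by rewrite (min_l a1) (max_r ler01).
Qed.

Lemma concat_zero f g : concat f g zero = f zero.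
Proof.
by rewrite /concat uval0 invr_ge0 ler0n clamp_le0// mulr0.
Qed.

Lemma concat_one f g : concat f g one = g one.
Proof.
rewrite /concat uval1 ifF; first by rewrite clamp_ge1//; lra.
by apply/negP => ?; lra.
Qed.

Lemma concat_continuous f g : continuous f -> continuous g ->
  f one = g zero -> continuous (concat f g).
Proof.
move=> cf cg fg; apply: (@glue_continuous _ (@uval R)).
- exact: uval_continuous.
- apply: comp_continuous cf.
  under eq_fun do rewrite -[2 * _]addr0.
  exact/affine_continuous/uval_continuous.
- apply: comp_continuous cg.
  exact/affine_continuous/uval_continuous.
- by move=> t ->; rewrite clamp_ge1 ?clamp_le0//; lra.
Qed.

Lemma reverse_continuous f : continuous f -> continuous (reverse f).
Proof.
move=> cf; apply: comp_continuous cf.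
under eq_fun do rewrite addrC -mulN1r.
exact/affine_continuous/uval_continuous.
Qed.

Lemma reverse_zero f : reverse f zero = f one.
Proof. by rewrite /reverse uval0 subr0 clamp_ge1. Qed.

Lemma reverse_one f : reverse f one = f zero.
Proof. by rewrite /reverse uval1 subrr clamp_le0. Qed.

Lemma path_homotopic_refl f : continuous f -> path_homotopic f f.
Proof.
move=> cf; exists (fun p => f p.1); split=> //.
by apply: comp_continuous cf; exact: fst_continuous.
Qed.

Lemma path_homotopic_zero f g : path_homotopic f g -> f zero = g zero.
Proof. by move=> [F [_ F0 F1 Fz Fo]]; rewrite -F1 Fz. Qed.

Lemma path_homotopic_one f g : path_homotopic f g -> f one = g one.
Proof. by move=> [F [_ F0 F1 Fz Fo]]; rewrite -F1 Fo. Qed.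

Lemma path_homotopic_sym f g : path_homotopic f g -> path_homotopic g f.
Proof.
move=> fg; have [F [cF F0 F1 Fz Fo]] := fg.
exists (fun p => F (p.1, clamp (1 - uval p.2))); split.
- apply: comp_continuous cF; apply: pair_continuous.
    exact: fst_continuous.
  under eq_fun do rewrite addrC -mulN1r.
  apply: affine_continuous.
  exact: (comp_continuous (@snd_continuous _ _) (@uval_continuous R)).
- by move=> t /=; rewrite uval0 subr0 clamp_ge1.
- by move=> t /=; rewrite uval1 subrr clamp_le0.
- by move=> s /=; rewrite Fz (path_homotopic_zero fg).
- by move=> s /=; rewrite Fo (path_homotopic_one fg).
Qed.

Lemma path_homotopic_trans f g h :
  path_homotopic f g -> path_homotopic g h -> path_homotopic f h.
Proof.
move=> fg gh; have [F [cF F0 F1 Fz Fo]] := fg; have [G [cG G0 G1 Gz Go]] := gh.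
have cs : continuous (fun p : UI * UI => uval p.2).
  exact: (comp_continuous (@snd_continuous _ _) (@uval_continuous R)).
exists (fun p => if uval p.2 <= 2^-1 then F (p.1, clamp (2 * uval p.2))
                 else G (p.1, clamp (2 * uval p.2 - 1))); split.
- apply: (@glue_continuous _ (fun p : UI * UI => uval p.2)) => //.
  + apply: comp_continuous cF; apply: pair_continuous.
      exact: fst_continuous.
    under eq_fun do rewrite -[2 * _]addr0.
    exact: affine_continuous.
  + apply: comp_continuous cG; apply: pair_continuous.
      exact: fst_continuous.
    exact: affine_continuous.
  + move=> [t s]/= ->.
    rewrite clamp_ge1 ?clamp_le0 ?F1 ?G0//; lra.
- by move=> t /=; rewrite uval0 invr_ge0 ler0n mulr0 clamp_le0.
- move=> t /=; rewrite uval1 ifF; first by rewrite clamp_ge1//; lra.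
  by apply/negP => ?; lra.
- move=> s /=; case: ifP => _; first by rewrite Fz.
  by rewrite Gz (path_homotopic_zero fg).
- move=> s /=; case: ifP => _; first by rewrite Fo.
  by rewrite Go (path_homotopic_one fg).
Qed.

Lemma path_homotopic_concat f f' g g' : f one = g zero ->
  path_homotopic f f' -> path_homotopic g g' ->
  path_homotopic (concat f g) (concat f' g').
Proof.
move=> fg [F [cF F0 F1 Fz Fo]] [G [cG G0 G1 Gz Go]].
have ct : continuous (fun p : UI * UI => uval p.1).
  exact: (comp_continuous (@fst_continuous _ _) (@uval_continuous R)).
exists (fun p => concat (fun t => F (t, p.2)) (fun t => G (t, p.2)) p.1); split.
- apply: (@glue_continuous _ (fun p : UI * UI => uval p.1)) => //.
  + apply: comp_continuous cF; apply: pair_continuous; last first.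
      exact: snd_continuous.
    under eq_fun do rewrite -[2 * _]addr0.
    exact: affine_continuous.
  + apply: comp_continuous cG; apply: pair_continuous; last first.
      exact: snd_continuous.
    exact: affine_continuous.
  + move=> [t s]/= ->.
    rewrite clamp_ge1 ?clamp_le0 ?Fo ?Gz//; lra.
- by move=> t /=; rewrite /concat F0 G0.
- by move=> t /=; rewrite /concat F1 G1.
- by move=> s /=; rewrite !concat_zero Fz.
- by move=> s /=; rewrite !concat_one Go.
Qed.

Lemma path_homotopic_reverse f g :
  path_homotopic f g -> path_homotopic (reverse f) (reverse g).
Proof.
move=> [F [cF F0 F1 Fz Fo]].
exists (fun p => F (clamp (1 - uval p.1), p.2)); split.
- apply: comp_continuous cF; apply: pair_continuous; last exact: snd_continuous.
  under eq_fun do rewrite addrC -mulN1r.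
  apply: affine_continuous.
  exact: (comp_continuous (@fst_continuous _ _) (@uval_continuous R)).
- by move=> t /=; rewrite F0.
- by move=> t /=; rewrite F1.
- by move=> s /=; rewrite reverse_zero uval0 subr0 clamp_ge1.
- by move=> s /=; rewrite reverse_one uval1 subrr clamp_le0.
Qed.

Lemma path_homotopic_reparam f (phi psi : R -> R) :
  continuous f -> continuous phi -> continuous psi ->
  phi 0 = psi 0 -> phi 1 = psi 1 ->
  path_homotopic (fun t => f (clamp (phi (uval t))))
                 (fun t => f (clamp (psi (uval t)))).
Proof.
move=> cf cphi cpsi e0 e1.
have cu (chi : R -> R) : continuous chi ->
    continuous (fun p : UI * UI => chi (uval p.1)).
  move=> cchi; apply: comp_continuous cchi.
  exact: (comp_continuous (@fst_continuous _ _) (@uval_continuous R)).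
have cs : continuous (fun p : UI * UI => uval p.2).
  exact: (comp_continuous (@snd_continuous _ _) (@uval_continuous R)).
exists (fun p => f (clamp ((1 - uval p.2) * phi (uval p.1)
                           + uval p.2 * psi (uval p.1)))); split.
- apply: comp_continuous cf; apply: comp_continuous; last exact: clamp_continuous.
  move=> p; apply: cvgD; apply: cvgM; [|exact: cu|exact: cs|exact: cu].
  by apply: cvgB; [exact: cvg_cst|exact: cs].
- by move=> t /=; rewrite uval0 subr0 mul1r mul0r addr0.
- by move=> t /=; rewrite uval1 subrr mul1r mul0r add0r.
- by move=> s /=; rewrite uval0 -e0 -mulrDl subrK mul1r.
- by move=> s /=; rewrite uval1 -e1 -mulrDl subrK mul1r.
Qed.

End paths.

Section group_laws.
Context {R : realType} {X : topologicalType}.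
Local Notation UI := (unit_interval R).
Implicit Types (f g h : UI -> X).

Lemma concatE_le f g (t : UI) : uval t <= 2^-1 ->
  concat f g t = f (clamp (2 * uval t)).
Proof. by rewrite /concat => ->. Qed.

Lemma concatE_gt f g (t : UI) : 2^-1 < uval t ->
  concat f g t = g (clamp (2 * uval t - 1)).
Proof. by rewrite /concat leNgt => ->. Qed.

Lemma min_continuous (u v : R -> R) : continuous u -> continuous v ->
  continuous (fun r => Num.min (u r) (v r)).
Proof.
by move=> cu cv r; apply: (@continuous_min R R u v); [exact: cu|exact: cv].
Qed.

Lemma max_continuous (u v : R -> R) : continuous u -> continuous v ->
  continuous (fun r => Num.max (u r) (v r)).
Proof.
by move=> cu cv r; apply: (@continuous_max R R u v); [exact: cu|exact: cv].
Qed.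

Lemma real_affine_continuous (k b : R) : continuous (fun r : R => k * r + b).
Proof.
by move=> r; apply: cvgD; [apply: cvgMr; exact: cvg_id|exact: cvg_cst].
Qed.

Lemma real_cst_continuous (b : R) : continuous (fun _ : R => b).
Proof. by move=> r; exact: cvg_cst. Qed.

Lemma real_id_continuous : continuous (fun r : R => r).
Proof. by move=> r; exact: cvg_id. Qed.

Lemma path_homotopicA f g h : continuous f -> continuous g -> continuous h ->
  f one = g zero -> g one = h zero ->
  path_homotopic (concat (concat f g) h) (concat f (concat g h)).
Proof.
move=> cf cg ch fg gh.
set k := concat f (concat g h).
have ck : continuous k.
  apply: concat_continuous => //; first exact: concat_continuous.
  by rewrite concat_zero.
pose phi (r : R) := Num.min (2 * r + 0) (Num.min (1 * r + 4^-1) (2^-1 * r + 2^-1)).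
have -> : k = fun t => k (clamp (uval t)) by apply/funext => t; rewrite uvalK.
have -> : concat (concat f g) h = fun t => k (clamp (phi (uval t))).
  apply/funext => t; have /andP[t0 t1] := uval_itv t.
  have [t2|t2] := leP (uval t) 2^-1; last first.
    have -> : phi (uval t) = 2^-1 * uval t + 2^-1.
      by rewrite /phi [X in Num.min _ X]min_r ?min_r; lra.
    rewrite concatE_gt// /k concatE_gt; last by rewrite clampK; lra.
    rewrite clampK; last lra.
    have E : uval (clamp (2 * (2^-1 * uval t + 2^-1) - 1)) = uval t.
      by rewrite clampK; lra.
    by rewrite concatE_gt E.
  rewrite concatE_le//.
  have t2E : uval (clamp (2 * uval t)) = 2 * uval t by rewrite clampK; lra.
  have [t4|t4] := leP (uval t) 4^-1.
    have -> : phi (uval t) = 2 * uval t.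
      by rewrite /phi addr0 min_l// le_min; apply/andP; split; lra.
    by rewrite concatE_le ?t2E /k ?concatE_le ?t2E//; lra.
  have -> : phi (uval t) = uval t + 4^-1.
    rewrite /phi [X in Num.min _ X]min_l; last lra.
    by rewrite min_r; lra.
  rewrite concatE_gt ?t2E; last lra.
  have E : uval (clamp (uval t + 4^-1)) = uval t + 4^-1 by rewrite clampK; lra.
  rewrite /k concatE_gt ?E; last lra.
  have E' : uval (clamp (2 * (uval t + 4^-1) - 1)) = 2 * uval t - 2^-1.
    by rewrite clampK; lra.
  by rewrite concatE_le ?E'; [congr (g (clamp _)); lra|lra].
apply: (@path_homotopic_reparam _ _ _ phi id) => //.
- apply: min_continuous; first exact: real_affine_continuous.
  by apply: min_continuous; exact: real_affine_continuous.
- exact: real_id_continuous.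
- by rewrite /phi min_l ?le_min; [lra|apply/andP; split; lra].
- rewrite /phi [X in Num.min _ X]min_r; last lra.
  by rewrite min_r; lra.
Qed.

Lemma path_homotopic_cstl f : continuous f ->
  path_homotopic (concat (cst (f zero)) f) f.
Proof.
move=> cf.
pose phi (r : R) := Num.max 0 (2 * r - 1).
have -> : concat (cst (f zero)) f = fun t => f (clamp (phi (uval t))).
  apply/funext => t; have [t2|t2] := leP (uval t) 2^-1.
    rewrite concatE_le//= [in RHS]clamp_le0//.
    by rewrite /phi ge_max lexx/=; lra.
  by rewrite concatE_gt// /phi max_r//; lra.
rewrite [X in path_homotopic _ X](_ : f = fun t => f (clamp (uval t))); last first.
  by apply/funext => t; rewrite uvalK.
apply: (@path_homotopic_reparam _ _ _ phi id) => //.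
- apply: max_continuous; first exact: real_cst_continuous.
  exact: real_affine_continuous.
- exact: real_id_continuous.
- by rewrite /phi max_l; lra.
- by rewrite /phi max_r; lra.
Qed.

Lemma path_homotopic_cstr f : continuous f ->
  path_homotopic (concat f (cst (f one))) f.
Proof.
move=> cf.
pose phi (r : R) := Num.min 1 (2 * r + 0).
have -> : concat f (cst (f one)) = fun t => f (clamp (phi (uval t))).
  apply/funext => t; have [t2|t2] := leP (uval t) 2^-1.
    by rewrite concatE_le// /phi addr0 min_r//; lra.
  rewrite concatE_gt//= [in RHS]clamp_ge1//.
  by rewrite /phi le_min lexx/=; lra.
rewrite [X in path_homotopic _ X](_ : f = fun t => f (clamp (uval t))); last first.
  by apply/funext => t; rewrite uvalK.
apply: (@path_homotopic_reparam _ _ _ phi id) => //.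
- apply: min_continuous; first exact: real_cst_continuous.
  exact: real_affine_continuous.
- exact: real_id_continuous.
- by rewrite /phi min_r; lra.
- by rewrite /phi min_l; lra.
Qed.

Lemma reverseK f : reverse (reverse f) = f.
Proof.
apply/funext => t; have /andP[t0 t1] := uval_itv t.
rewrite /reverse clampK; last lra.
by rewrite opprB addrC subrK uvalK.
Qed.

Lemma path_homotopic_reverser f : continuous f ->
  path_homotopic (concat f (reverse f)) (cst (f zero)).
Proof.
move=> cf.
pose phi (r : R) := Num.min (2 * r + 0) (- 2 * r + 2).
have -> : concat f (reverse f) = fun t => f (clamp (phi (uval t))).
  apply/funext => t; have /andP[t0 t1] := uval_itv t.
  have [t2|t2] := leP (uval t) 2^-1.
    by rewrite concatE_le// /phi addr0 min_l//; lra.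
  rewrite concatE_gt// /reverse clampK; last lra.
  by rewrite /phi min_r; [congr (f (clamp _)); lra|lra].
have -> : cst (f zero) = fun t : UI => f (clamp ((fun _ : R => 0) (uval t))).
  by apply/funext => t /=; rewrite clamp_le0.
apply: (@path_homotopic_reparam _ _ _ phi (fun _ => 0)) => //.
- by apply: min_continuous; exact: real_affine_continuous.
- exact: real_cst_continuous.
- by rewrite /phi min_l; lra.
- by rewrite /phi min_r; lra.
Qed.

Lemma path_homotopic_reversel f : continuous f ->
  path_homotopic (concat (reverse f) f) (cst (f one)).
Proof.
move=> cf; have := path_homotopic_reverser (reverse_continuous cf).
by rewrite reverseK reverse_zero.
Qed.

End group_laws.

Section typed_paths.
Context {R : realType} {X : topologicalType}.
Local Notation UI := (unit_interval R).

Lemma path_continuous (x y : X) (f : {path UI from x to y}) : continuous f.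
Proof. exact: cts_fun. Qed.
Arguments path_continuous {x y} f.

Section operations.
Context {x y z : X}.
Implicit Types (f : {path UI from x to y}) (g : {path UI from y to z}).

Definition path_concat f g : {path UI from x to z} :=
  mk_path (concat_continuous (path_continuous f) (path_continuous g)
             (etrans (@path_one _ _ _ _ f) (esym (@path_zero _ _ _ _ g))))
    (etrans (concat_zero f g) (@path_zero _ _ _ _ f))
    (etrans (concat_one f g) (@path_one _ _ _ _ g)).

Definition path_reverse f : {path UI from y to x} :=
  mk_path (reverse_continuous (path_continuous f))
    (etrans (reverse_zero f) (@path_one _ _ _ _ f))
    (etrans (reverse_one f) (@path_zero _ _ _ _ f)).

End operations.

Definition path_cst (x : X) : {path UI from x to x} := cst x.

End typed_paths.
Arguments path_continuous {R X x y} f.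

Notation "f ∗ g" := (path_concat f g) (at level 40, left associativity).

Section fundamental_group.
Context (R : realType) {X : topologicalType} (x : X).
Local Notation UI := (unit_interval R).

Definition loop : Type := {path UI from x to x}.

HB.instance Definition _ := Choice.on loop.

Definition loop_homotopic (f g : loop) : bool := `[< path_homotopic f g >].

Lemma loop_homotopic_refl : reflexive loop_homotopic.
Proof. by move=> f; apply/asboolP/path_homotopic_refl; exact: path_continuous. Qed.

Lemma loop_homotopic_sym : symmetric loop_homotopic.
Proof. by move=> f g; apply/asboolP/asboolP => /path_homotopic_sym. Qed.

Lemma loop_homotopic_trans : transitive loop_homotopic.
Proof.
by move=> g f h /asboolP fg /asboolP gh; apply/asboolP/(path_homotopic_trans fg).
Qed.

Canonical loop_homotopic_equiv :=
  EquivRel loop_homotopic loop_homotopic_refl loop_homotopic_sym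
    loop_homotopic_trans.

Definition pi1 : Type := {eq_quot loop_homotopic_equiv}.

HB.instance Definition _ := Choice.on pi1.
HB.instance Definition _ := EqQuotient.on pi1.

Definition loop_class (f : loop) : pi1 := \pi_pi1 f.

Lemma loop_classP (f g : loop) :
  loop_class f = loop_class g <-> path_homotopic f g.
Proof.
by split=> [/eqmodP/asboolP//|fg]; apply/eqmodP/asboolP.
Qed.

Definition pi1_one : pi1 := loop_class (path_cst x).
Definition pi1_mul (a b : pi1) : pi1 := loop_class (repr a ∗ repr b).
Definition pi1_inv (a : pi1) : pi1 := loop_class (path_reverse (repr a)).

Lemma repr_loop_class (f : loop) : path_homotopic (repr (loop_class f)) f.
Proof. by apply/loop_classP; exact: reprK. Qed.

Lemma loop_class_surj (a : pi1) : a = loop_class (repr a).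
Proof. by rewrite /loop_class reprK. Qed.

Lemma pi1_mulE (f g : loop) :
  pi1_mul (loop_class f) (loop_class g) = loop_class (f ∗ g).
Proof.
apply/loop_classP; apply: path_homotopic_concat (repr_loop_class f) (repr_loop_class g).
by rewrite path_one path_zero.
Qed.

Lemma pi1_invE (f : loop) : pi1_inv (loop_class f) = loop_class (path_reverse f).
Proof. by apply/loop_classP/path_homotopic_reverse/repr_loop_class. Qed.

Lemma pi1_mulA : associative pi1_mul.
Proof.
move=> a b c; rewrite (loop_class_surj a) (loop_class_surj b) (loop_class_surj c).
rewrite !pi1_mulE; apply/loop_classP/path_homotopic_sym.
by apply: path_homotopicA;
  rewrite ?path_one ?path_zero//; exact: path_continuous.
Qed.

Lemma pi1_mul1 : left_id pi1_one pi1_mul.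
Proof.
move=> a; rewrite (loop_class_surj a) pi1_mulE; apply/loop_classP.
have := path_homotopic_cstl (path_continuous (repr a)).
by rewrite path_zero.
Qed.

Lemma pi1_mulr1 : right_id pi1_one pi1_mul.
Proof.
move=> a; rewrite (loop_class_surj a) pi1_mulE; apply/loop_classP.
have := path_homotopic_cstr (path_continuous (repr a)).
by rewrite path_one.
Qed.

Lemma pi1_mulV : left_inverse pi1_one pi1_inv pi1_mul.
Proof.
move=> a; rewrite (loop_class_surj a) pi1_invE pi1_mulE; apply/loop_classP.
have := path_homotopic_reversel (path_continuous (repr a)).
by rewrite path_one.
Qed.

Lemma pi1_mulrV : right_inverse pi1_one pi1_inv pi1_mul.
Proof.
move=> a; rewrite (loop_class_surj a) pi1_invE pi1_mulE; apply/loop_classP.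
have := path_homotopic_reverser (path_continuous (repr a)).
by rewrite path_zero.
Qed.

HB.instance Definition _ := isGroup.Build pi1
  pi1_mulA pi1_mul1 pi1_mulr1 pi1_mulV pi1_mulrV.

End fundamental_group.

Section path_space.
Context (R : realType) {X : topologicalType} (x : X).
Local Notation UI := (unit_interval R).

(* P(X, x). A record rather than a sigma type, as the latter would inherit the
   disjoint union topology over the endpoints. *)
Record path_from : Type := PathFrom {
  path_end : X;
  path_of :> {path UI from x to path_end} }.

HB.instance Definition _ := gen_eqMixin path_from.
HB.instance Definition _ := gen_choiceMixin path_from.
HB.instance Definition _ := isPointed.Build path_from (PathFrom (path_cst x)).
HB.instance Definition _ := Topological.copy path_from
  (initial_topology (fun f : path_from => (f : UI -> X) : {compact-open, UI -> X})).

Definition path_from_homotopic (f g : path_from) : bool :=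
  `[< path_homotopic f g >].

Lemma path_from_homotopic_refl : reflexive path_from_homotopic.
Proof. by move=> f; apply/asboolP/path_homotopic_refl; exact: path_continuous. Qed.

Lemma path_from_homotopic_sym : symmetric path_from_homotopic.
Proof. by move=> f g; apply/asboolP/asboolP => /path_homotopic_sym. Qed.

Lemma path_from_homotopic_trans : transitive path_from_homotopic.
Proof.
by move=> g f h /asboolP fg /asboolP gh; apply/asboolP/(path_homotopic_trans fg).
Qed.

Canonical path_from_homotopic_equiv :=
  EquivRel path_from_homotopic path_from_homotopic_refl path_from_homotopic_sym
    path_from_homotopic_trans.

Definition path_classes : Type := {eq_quot path_from_homotopic_equiv}.

HB.instance Definition _ := Choice.on path_classes.
HB.instance Definition _ := EqQuotient.on path_classes.

Definition path_class (f : path_from) : path_classes := \pi_path_classes f.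

Lemma path_classP (f g : path_from) :
  path_class f = path_class g <-> path_homotopic f g.
Proof.
by split=> [/eqmodP/asboolP//|fg]; apply/eqmodP/asboolP.
Qed.

Definition pi1_incl (a : pi1 R x) : path_classes :=
  path_class (PathFrom (repr a)).

Lemma pi1_inclE (f : loop R x) :
  pi1_incl (loop_class f) = path_class (PathFrom f).
Proof. by apply/path_classP; exact: repr_loop_class. Qed.

Lemma pi1_incl_inj : injective pi1_incl.
Proof.
move=> a b /path_classP ab.
by rewrite (loop_class_surj a) (loop_class_surj b); apply/loop_classP.
Qed.

End path_space.
Arguments pi1_incl {R X x} a.

Section whisker.
Context (R : realType) {X : topologicalType} (x : X).
Local Notation UI := (unit_interval R).

(* N([f], U); it depends only on the class of [f], see [whisker_nbhd_sub]. *)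
Definition whisker_nbhd (f : path_from R x) (U : set X) :
    set (path_classes R x) :=
  [set path_class (PathFrom (f ∗ d)) |
    d in [set d : path_from R (path_end f) | range d `<=` U]].

Definition whisker_index : set (path_from R x * set X) :=
  [set fU | open_nbhs (path_end fU.1) fU.2].

Definition whisker_path_classes : Type := path_classes R x.

Lemma whisker_cover :
  \bigcup_(fU in whisker_index) whisker_nbhd fU.1 fU.2 =
    [set: whisker_path_classes].
Proof.
rewrite eqEsubset; split=> // c _.
exists (repr c, setT); first by split=> //; exact: openT.
exists (PathFrom (path_cst (path_end (repr c)))) => //=.
rewrite -[RHS](@reprK _ (path_classes R x)); apply/path_classP => /=.
have := path_homotopic_cstr (path_continuous (repr c)).
by rewrite path_one.
Qed.

Lemma range_concat (f g : UI -> X) (U : set X) :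
  range f `<=` U -> range g `<=` U -> range (concat f g) `<=` U.
Proof.
move=> fU gU _ [t _ <-]; rewrite /concat; case: ifP => _.
  by apply: fU; exists (clamp (2 * uval t)).
by apply: gU; exists (clamp (2 * uval t - 1)).
Qed.

Lemma whisker_nbhd_sub (f g : path_from R x) (U V : set X) :
  V `<=` U -> whisker_nbhd f U (path_class g) ->
  whisker_nbhd g V `<=` whisker_nbhd f U.
Proof.
move=> VU [d dU /path_classP fdg] _ [e eV <-].
have eqe : path_end d = path_end g.
  by have := path_homotopic_one fdg; rewrite !path_one.
have e0 : (e : UI -> X) zero = path_end d by rewrite path_zero eqe.
pose e' : {path UI from path_end d to path_end e} :=
  mk_path (path_continuous e) e0 (@path_one _ _ _ _ e).
exists (PathFrom (d ∗ e')).
  by apply: range_concat => //; exact: subset_trans VU.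
apply/path_classP => /=.
apply: (@path_homotopic_trans _ _ _ (concat (concat f d) e)).
  by apply/path_homotopic_sym/path_homotopicA; rewrite ?path_one ?path_zero//;
    exact: path_continuous.
apply: path_homotopic_concat fdg _.
  by rewrite path_one path_zero.
by apply: path_homotopic_refl; exact: path_continuous.
Qed.

Lemma whisker_nbhd_end (f g : path_from R x) (U : set X) :
  whisker_nbhd f U (path_class g) -> U (path_end g).
Proof.
move=> [d dU /path_classP/path_homotopic_one]; rewrite !path_one /= => <-.
by apply: dU; exists one => //; rewrite path_one.
Qed.

Lemma whisker_join (fU gV : path_from R x * set X) (c : whisker_path_classes) :
  whisker_index fU -> whisker_index gV ->
  whisker_nbhd fU.1 fU.2 c -> whisker_nbhd gV.1 gV.2 c ->
  exists hW, [/\ whisker_index hW, whisker_nbhd hW.1 hW.2 c &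
    whisker_nbhd hW.1 hW.2 `<=`
      whisker_nbhd fU.1 fU.2 `&` whisker_nbhd gV.1 gV.2].
Proof.
case: fU gV => f U [g V] [/= oU fU] [/= oV gV].
rewrite -[c](@reprK _ (path_classes R x)) -/(path_class _); set h := repr c => Uh Vh.
exists (h, U `&` V); split => /=.
- by split; [exact: openI|split; [exact: whisker_nbhd_end Uh|
    exact: whisker_nbhd_end Vh]].
- exists (PathFrom (path_cst (path_end h))) => /=.
    by move=> _ [t _ <-]; split; [exact: whisker_nbhd_end Uh|
      exact: whisker_nbhd_end Vh].
  apply/path_classP => /=.
  have := path_homotopic_cstr (path_continuous h).
  by rewrite path_one.
- by move=> e he; split; [apply: whisker_nbhd_sub Uh _ he|
    apply: whisker_nbhd_sub Vh _ he] => y [].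
Qed.

HB.instance Definition _ := Choice.on whisker_path_classes.
HB.instance Definition _ :=
  isBaseTopological.Build whisker_path_classes whisker_cover whisker_join.

End whisker.

Section pi1_topologies.
Context (R : realType) {X : topologicalType} (x : X).

Definition pi1_qtop : Type := pi1 R x.

HB.instance Definition _ := Topological.copy pi1_qtop
  (initial_topology (pi1_incl : pi1 R x -> quotient_topology (path_classes R x))).

Definition pi1_wh : Type := pi1 R x.

HB.instance Definition _ := Topological.copy pi1_wh
  (initial_topology (pi1_incl : pi1 R x -> whisker_path_classes R x)).

End pi1_topologies.

Section notions.
Context {R : realType} {X : topologicalType}.
Local Notation UI := (unit_interval R).
Local Open Scope group_scope.

Definition is_subgroup (x : X) (H : set (pi1 R x)) : Prop := group_closed (mem H).

Definition pi1_setmul (x : X) (A B : set (pi1 R x)) : set (pi1 R x) :=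
  [set a * b | a in A & b in B].

(* The image of pi_1(U, y) in pi_1(X, y): a loop in the subspace [U] is a loop
   of [X] with range in [U]. *)
Definition pi1_image (y : X) (U : set X) : set (pi1 R y) :=
  [set loop_class d | d in [set d : loop R y | range d `<=` U]].
Arguments pi1_image : clear implicits.

(* pi(a, V), where a ends at z and V is a neighbourhood of z. *)
Definition path_pi1 (y z : X) (a : {path UI from y to z}) (V : set X) :
    set (pi1 R y) :=
  [set loop_class (a ∗ d ∗ path_reverse a) |
    d in [set d : loop R z | range d `<=` V]].

(* H_a *)
Definition transport (x y : X) (H : set (pi1 R x)) (a : {path UI from x to y}) :
    set (pi1 R y) :=
  [set loop_class (path_reverse a ∗ d ∗ a) |
    d in [set d : loop R x | H (loop_class d)]].

Definition locally_quasinormal (y : X) (K : set (pi1 R y)) :=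
  forall (z : X) (c : {path UI from y to z}) (U : set X), open_nbhs z U ->
  exists V, [/\ open_nbhs z V, V `<=` U &
    pi1_setmul K (path_pi1 c V) = pi1_setmul (path_pi1 c V) K].

Definition SLT_at (y : X) (K : set (pi1 R y)) :=
  forall (z : X) (c : {path UI from y to z}) (U : set X), open_nbhs y U ->
  exists2 V, open_nbhs z V & path_pi1 c V `<=` pi1_setmul K (pi1_image y U).

Definition SLT_space (x0 : X) (H : set (pi1 R x0)) :=
  forall (y : X) (d : {path UI from x0 to y}), SLT_at (transport H d).

End notions.

Section path_connectedness.
Context (R : realType) (X : topologicalType).
Local Notation UI := (unit_interval R).

Definition path_connected (A : set X) := forall x y, A x -> A y ->
  exists f : {path UI from x to y}, range f `<=` A.

Definition locally_path_connected := forall (x : X) (U : set X),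
  open_nbhs x U ->
  exists V, [/\ open_nbhs x V, V `<=` U & path_connected V].

End path_connectedness.

(* Main.v *)
Require Import Defs.
From Corelib Require Import -(notations) Setoid Morphisms.
From mathcomp Require Import all_boot all_order all_algebra.
From mathcomp Require Import lra.
From mathcomp Require Import boolp classical_sets functions.
From mathcomp Require Import reals topology normedtype homotopy.
Import numFieldNormedType.Exports.

(** Reading loops at x as paths f * d and sliding the tail d towards a constant
    shows that the whisker topology is finer than the quotient topology, which
    gives one implication for every subset of the fundamental group.

    Conversely let K = H_alpha and let a be a class outside K. Whisker closedness
    gives an open U around x with a pi_1(U) disjoint from K; by local
    quasinormality U shrinks to V for which L = K pi_1(V) is a subgroup, and a is
    not in L. By the small loop transfer property every point h(t) of a path h
    from x has a neighbourhood whose loops, conjugated by h up to time t, lie in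
    L. Propagating along [0, 1] by connectedness, every h' close to h has its
    endpoint joined to that of h by a small path m with [h' m h^-1] in L. Hence
    the condition "h ends in V and h l is not in L for any path l in V from the
    end of h to x" is open in the compact-open topology; it holds for a and fails
    on K. *)

Set Implicit Arguments.
Unset Strict Implicit.
Unset Printing Implicit Defensive.

Import Order.TTheory GRing.Theory Num.Theory.

Local Open Scope classical_set_scope.
Local Open Scope ring_scope.

(** Endpoints fixed in the type allow setoid rewriting under [∗]. *)
Definition homotopic (R : realType) (X : topologicalType) (x y : X)
    (f g : {path (unit_interval R) from x to y}) : Prop :=
  path_homotopic f g.

Lemma homotopic_refl (R : realType) (X : topologicalType) (x y : X)
  (f : {path (unit_interval R) from x to y}) : homotopic f f.
Proof. exact/path_homotopic_refl/path_continuous. Qed.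
#[local] Hint Resolve homotopic_refl : core.

(** * Groupoid laws for paths up to homotopy, and arcs of a path *)

Section path_calculus.
Context {R : realType} {X : topologicalType}.
Local Notation UI := (unit_interval R).
Implicit Types w x y z : X.

#[global] Instance homotopic_equivalence x y : Equivalence (@homotopic R X x y).
Proof.
split=> [f|f g|f g h].
- exact/path_homotopic_refl/path_continuous.
- exact: path_homotopic_sym.
- exact: path_homotopic_trans.
Qed.

#[global] Instance path_concat_proper x y z :
  Proper (respectful (@homotopic R X x y)
      (respectful (@homotopic R X y z) (@homotopic R X x z)))
    (@path_concat R X x y z).
Proof.
move=> f f' ff' g g' gg'; apply: path_homotopic_concat => //.
by rewrite path_one path_zero.
Qed.

#[global] Instance path_reverse_proper x y :
  Proper (respectful (@homotopic R X x y) (@homotopic R X y x)) (@path_reverse R X x y).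
Proof. by move=> f f'; exact: path_homotopic_reverse. Qed.

#[global] Instance loop_class_proper x :
  Proper (respectful (@homotopic R X x x) eq) (@loop_class R X x).
Proof. by move=> f f' /loop_classP. Qed.

Lemma homotopicA w x y z (f : {path UI from w to x}) (g : {path UI from x to y})
    (h : {path UI from y to z}) :
  homotopic (f ∗ (g ∗ h)) (f ∗ g ∗ h).
Proof.
symmetry; apply: path_homotopicA; rewrite ?path_one ?path_zero//;
  exact: path_continuous.
Qed.

Lemma homotopic1p x y (f : {path UI from x to y}) :
  homotopic (path_cst x ∗ f) f.
Proof.
by have := path_homotopic_cstl (path_continuous f); rewrite path_zero.
Qed.

Lemma homotopicp1 x y (f : {path UI from x to y}) :
  homotopic (f ∗ path_cst y) f.
Proof.
by have := path_homotopic_cstr (path_continuous f); rewrite path_one.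
Qed.

Lemma homotopicVp x y (f : {path UI from x to y}) :
  homotopic (path_reverse f ∗ f) (path_cst y).
Proof.
by have := path_homotopic_reversel (path_continuous f); rewrite path_one.
Qed.

Lemma homotopicpV x y (f : {path UI from x to y}) :
  homotopic (f ∗ path_reverse f) (path_cst x).
Proof.
by have := path_homotopic_reverser (path_continuous f); rewrite path_zero.
Qed.

Lemma homotopicVpK x y z (f : {path UI from x to y}) (g : {path UI from z to y}) :
  homotopic (g ∗ path_reverse f ∗ f) g.
Proof. by rewrite -homotopicA homotopicVp homotopicp1. Qed.

Lemma homotopicpVK x y z (f : {path UI from x to y}) (g : {path UI from z to x}) :
  homotopic (g ∗ f ∗ path_reverse f) g.
Proof. by rewrite -homotopicA homotopicpV homotopicp1. Qed.

Lemma homotopicV_concat x y z (f : {path UI from x to y}) (g : {path UI from y to z}) :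
  homotopic (path_reverse (f ∗ g)) (path_reverse g ∗ path_reverse f).
Proof.
rewrite -[X in homotopic _ X]homotopic1p -(homotopicVp (f ∗ g)).
by rewrite !homotopicA !homotopicpVK.
Qed.

Lemma path_reverseK x y (f : {path UI from x to y}) :
  path_reverse (path_reverse f) = f.
Proof. by apply/path_eqP => t; rewrite [LHS](congr1 (@^~ t) (reverseK f)). Qed.

(** Normalizes words as in a free groupoid: reversals move onto letters, brackets go to the left,
    inverse neighbours cancel. *)
Definition homotopicE := (homotopicV_concat, path_reverseK, homotopicA,
  homotopicVpK, homotopicpVK, homotopic1p, homotopicp1, homotopicVp, homotopicpV).

Lemma path_arc_continuous x y (f : {path UI from x to y}) (a b : R) :
  continuous (fun t : UI => f (clamp (a + (b - a) * uval t))).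
Proof.
apply: (comp_continuous _ (path_continuous f)).
under eq_fun do rewrite addrC.
exact/affine_continuous/uval_continuous.
Qed.

Lemma path_arc_zero x y (f : {path UI from x to y}) (a b : R) :
  f (clamp (a + (b - a) * uval (zero : UI))) = f (clamp a).
Proof. by rewrite uval0 mulr0 addr0. Qed.

Lemma path_arc_one x y (f : {path UI from x to y}) (a b : R) :
  f (clamp (a + (b - a) * uval (one : UI))) = f (clamp b).
Proof. by rewrite uval1 mulr1 addrC subrK. Qed.

(* [f] run linearly from parameter [a] to parameter [b], in whichever order these
   come; parameters outside [0, 1] are clamped. The endpoints come with equations
   so that arcs meeting at propositionally equal points can be concatenated. *)
Definition path_arc x y (f : {path UI from x to y}) (a b : R) p q
    (fa : f (clamp a) = p) (fb : f (clamp b) = q) : {path UI from p to q} :=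
  mk_path (@path_arc_continuous _ _ f a b)
    (etrans (path_arc_zero f a b) fa) (etrans (path_arc_one f a b) fb).

(** Both sides are [f] after real functions that agree at 0 and 1, hence homotopic whatever the
    order of [a], [b] and [c]. *)
Lemma path_arc_concat x y (f : {path UI from x to y}) (a b c : R) p q r
   (fa fa' : f (clamp a) = p) (fb fb' : f (clamp b) = q) (fc fc' : f (clamp c) = r) :
  homotopic (path_arc fa fb ∗ path_arc fb' fc) (path_arc fa' fc').
Proof.
(* On the first half [phi] runs from [a] to [b], on the second from [b] to [c]. *)
pose phi (t : R) :=
    a + (b - a) * Num.min 1 (2 * t + 0) + (c - b) * Num.max 0 (2 * t - 1).
pose psi (t : R) := (c - a) * t + a.
have -> : homotopic (path_arc fa fb ∗ path_arc fb' fc) (path_arc fa' fc') =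
  path_homotopic (fun t : UI => f (clamp (phi (uval t))))
                 (fun t => f (clamp (psi (uval t)))).
  rewrite /homotopic; congr path_homotopic; apply/funext => t; last first.
    by rewrite /psi addrC.
  have /andP[t0 t1] := uval_itv t.
  have [t2|t2] := leP (uval t) 2^-1.
    rewrite [LHS]concatE_le//= /path_arc /mk_path clampK; last lra.
    by congr (f (clamp _)); rewrite /phi min_r ?max_l ?addr0 ?mulr0 ?addr0//; lra.
  rewrite [LHS]concatE_gt//= /path_arc /mk_path clampK; last lra.
  by congr (f (clamp _)); rewrite /phi min_l ?max_r//; lra.
apply: path_homotopic_reparam.
- exact: path_continuous.
- have c1 : continuous (fun t : R => Num.min 1 (2 * t + 0)).
    by apply: Defs.min_continuous; [exact: real_cst_continuous|
      exact: real_affine_continuous].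
  have c2 : continuous (fun t : R => Num.max 0 (2 * t - 1)).
    by apply: Defs.max_continuous; [exact: real_cst_continuous|
      exact: real_affine_continuous].
  move=> t; apply: cvgD; [apply: cvgD|]; [exact: cvg_cst|apply: cvgM|apply: cvgM];
    [exact: cvg_cst|exact: c1|exact: cvg_cst|exact: c2].
- exact: real_affine_continuous.
- by rewrite /phi /psi min_r ?max_l; lra.
- by rewrite /phi /psi min_l ?max_r; lra.
Qed.

Lemma path_arc_reverse x y (f : {path UI from x to y}) (a b : R) p q
   (fa fa' : f (clamp a) = p) (fb fb' : f (clamp b) = q) :
  path_reverse (path_arc fa fb) = path_arc fb' fa'.
Proof.
apply/path_eqP => t; have /andP[t0 t1] := uval_itv t.
have tE : uval (clamp (1 - uval t)) = 1 - uval t by rewrite clampK; lra.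
change (f (clamp (a + (b - a) * uval (clamp (1 - uval t)))) =
        f (clamp (b + (a - b) * uval t))).
by rewrite tE; congr (f (clamp _)); lra.
Qed.

Lemma range_path_arc x y (f : {path UI from x to y}) (a b l u : R) p q
   (fa : f (clamp a) = p) (fb : f (clamp b) = q) :
  l <= a <= u -> l <= b <= u ->
  range (path_arc fa fb) `<=` [set f (clamp c) | c in `[l, u]].
Proof.
move=> /andP[la au] /andP[lb bu] _ [t _ <-]; have /andP[t0 t1] := uval_itv t.
exists (a + (b - a) * uval t) => //=; rewrite in_itv/=; apply/andP; split; nra.
Qed.

Lemma range_path_concat x y z (f : {path UI from x to y}) (g : {path UI from y to z})
    (U : set X) :
  range f `<=` U -> range g `<=` U -> range (f ∗ g) `<=` U.
Proof. exact: range_concat. Qed.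

Lemma range_path_reverse x y (f : {path UI from x to y}) (U : set X) :
  range f `<=` U -> range (path_reverse f) `<=` U.
Proof. by move=> fU _ [t _ <-]; apply: fU; exists (clamp (1 - uval t)). Qed.

End path_calculus.

(** * Subgroups of the fundamental group and their products *)

Section subgroups.
Context {R : realType} {X : topologicalType} {x : X}.
Implicit Types (H : set (pi1 R x)).
Local Open Scope group_scope.

Lemma loop_classM (f g : loop R x) :
  loop_class (f ∗ g) = loop_class f * loop_class g.
Proof. by rewrite -pi1_mulE. Qed.

Lemma loop_classV (f : loop R x) :
  loop_class (path_reverse f) = (loop_class f)^-1.
Proof. by rewrite -pi1_invE. Qed.

Lemma is_subgroup1 H : is_subgroup H -> H 1.
Proof. by case=> /set_mem. Qed.

Lemma is_subgroupV H a : is_subgroup H -> H a -> H a^-1.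
Proof. by move=> HH /mem_set/(group_closedV HH)/set_mem. Qed.

Lemma is_subgroupM H a b : is_subgroup H -> H a -> H b -> H (a * b).
Proof. by move=> HH /mem_set Ha /mem_set Hb; apply/set_mem/(group_closedM HH). Qed.

(** In [(a * b) * (c * d)^-1] only the block [b * d^-1 * c^-1] is out of order, and the inclusion
    reorders it. *)
Lemma is_subgroup_setmul (H K : set (pi1 R x)) :
  is_subgroup H -> is_subgroup K ->
  pi1_setmul K H `<=` pi1_setmul H K -> is_subgroup (pi1_setmul H K).
Proof.
move=> HH HK KH; split.
  apply/mem_set; exists 1; first exact: is_subgroup1.
  by exists 1; [exact: is_subgroup1|exact: mulg1].
move=> _ _ /set_mem[a Ha [b Kb <-]] /set_mem[c Hc [d Kd <-]]; apply/mem_set.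
have [e He [f Kf ef]] : pi1_setmul H K ((b * d^-1) * c^-1).
  apply: KH; exists (b * d^-1); first by apply: is_subgroupM => //; exact: is_subgroupV.
  by exists c^-1 => //; exact: is_subgroupV.
exists (a * e); first exact: is_subgroupM.
by exists f => //; rewrite -mulgA ef invgM !mulgA.
Qed.

End subgroups.

(** * The compact-open topology on paths against the whisker topology *)

Section path_topology.
Context {R : realType} {X : topologicalType} {x : X}.
Local Notation UI := (unit_interval R).

Lemma near_path_from (h : path_from R x) (K : set UI) (O : set X) :
  compact K -> open O -> h @` K `<=` O ->
  nbhs h [set h' : path_from R x | h' @` K `<=` O].
Proof.
move=> cK oO hKO.
apply: (@initial_continuous (path_from R x) {compact-open, UI -> X}
  (fun f : path_from R x => (f : UI -> X)) h [set g | g @` K `<=` O]).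
by apply: open_nbhs_nbhs; split => //; exact: compact_open_open.
Qed.

Lemma cvg_path_from (F : set_system (path_from R x)) (h : path_from R x) :
  Filter F ->
  (forall (K : set UI) (O : set X), compact K -> open O -> h @` K `<=` O ->
    F [set h' : path_from R x | h' @` K `<=` O]) ->
  F --> h.
Proof.
move=> FF Fh A [_ [[B oB <-] Bh BA]].
apply: filterS BA _.
have : fmap (fun f : path_from R x => (f : UI -> X) : {compact-open, UI -> X}) F -->
       ((h : UI -> X) : {compact-open, UI -> X}).
  by apply/compact_open_cvgP.
by apply; apply: open_nbhs_nbhs.
Qed.

(** For a representative [f], the paths [f ∗ d] converge to [f ∗ c1] as the open set containing [d]
    shrinks around the end of [f]; so some whisker neighbourhood of each class of [B] lies in
    [B]. *)
Lemma open_quotient_whisker (B : set (path_classes R x)) :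
  open (B : set (quotient_topology (path_classes R x))) ->
  open (B : set (whisker_path_classes R x)).
Proof.
move=> oB.
have {}oB : open (@path_class R X x @^-1` B) by exact: oB.
exists [set fU | whisker_index fU /\ whisker_nbhd fU.1 fU.2 `<=` B].
  by move=> fU [].
rewrite eqEsubset; split=> [c [fU [_ sB]]|c Bc]; first exact: sB.
pose f : path_from R x := repr c.
have fc : path_class f = c by exact: reprK.
pose G (U : set X) : set (path_from R x) :=
  [set PathFrom (f ∗ d) | d in [set d : path_from R (path_end f) | range d `<=` U]].
have FF : Filter (filter_from (open_nbhs (path_end f)) G).
  apply: filter_from_filter; first by exists setT; split=> //; exact: openT.
  move=> U V oU oV; exists (U `&` V); first exact: open_nbhsI.
  by move=> _ [d dUV <-]; split; exists d => // y /dUV[].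
pose c1 : {path UI from path_end f to path_end f} := path_cst (path_end f).
have FG : filter_from (open_nbhs (path_end f)) G --> PathFrom (f ∗ c1).
  apply: cvg_path_from => K O cK oO fKO.
  (* If [K] meets the open second half, then [O] contains the end of [f] and tails in [O] will do;
     otherwise [K] sees only [f] and every tail will do. *)
  have [[t Kt t2]|nK] := pselect (exists2 t, K t & 2^-1 < uval t).
    exists O; first split=> //.
      by apply: fKO; exists t => //=; rewrite [LHS]concatE_gt.
    move=> _ [d dO <-] _ [s Ks <-] /=; have [s2|s2] := leP (uval s) 2^-1.
      by apply: fKO; exists s => //=; rewrite [LHS]concatE_le// [RHS]concatE_le.
    by apply: dO; exists (clamp (2 * uval s - 1)) => //=; rewrite [RHS]concatE_gt.
  exists setT; first by split=> //; exact: openT.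
  move=> _ [d _ <-] _ [s Ks <-] /=; have [s2|s2] := leP (uval s) 2^-1; last first.
    by case: nK; exists s.
  by apply: fKO; exists s => //=; rewrite [LHS]concatE_le// [RHS]concatE_le.
have [|U oU GU] := FG (@path_class R X x @^-1` B).
  apply: open_nbhs_nbhs; split=> //=.
  suff -> : path_class (PathFrom (f ∗ c1)) = c by [].
  by rewrite -fc; apply/path_classP; exact: homotopicp1.
exists (f, U) => /=.
  by split=> //= _ [d dU <-]; apply: GU; exists d.
exists (PathFrom c1); last by rewrite -fc; apply/path_classP; exact: homotopicp1.
by move=> _ [t _ <-]; case: oU.
Qed.

End path_topology.

(** * Transfer of loops along nearby paths *)

Section transfer.
Context {R : realType} {X : topologicalType}.
Local Notation UI := (unit_interval R).
Implicit Types (x y p q r w : X) (W : set X).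

Definition path_prefix x y (f : {path UI from x to y}) (c : R) p
    (fc : f (clamp c) = p) : {path UI from x to p} :=
  path_arc (@path_zero _ _ _ _ f) fc.

Lemma path_prefix_concat x y (f : {path UI from x to y}) (a b : R) p q
    (fa fa' : f (clamp a) = p) (fb fb' : f (clamp b) = q) :
  homotopic (path_prefix fb) (path_prefix fa ∗ path_arc fa' fb').
Proof. by symmetry; exact: path_arc_concat. Qed.

Lemma path_prefix_one x y (f : {path UI from x to y}) (f1 : f (clamp 1) = y) :
  path_prefix f1 = f.
Proof.
apply/path_eqP => t; change (f (clamp (0 + (1 - 0) * uval t)) = f t).
by rewrite add0r subr0 mul1r uvalK.
Qed.

Lemma path_prefix_zero x y (f : {path UI from x to y}) (f0 : f (clamp 0) = x) :
  path_prefix f0 = path_cst x.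
Proof.
apply/path_eqP => t; change (f (clamp (0 + (0 - 0) * uval t)) = x).
by rewrite subr0 mul0r addr0 [LHS]path_zero.
Qed.

(** A groupoid identity: extending [f] by [a] and [g] by [b] multiplies the comparison loop by a
    loop at [r] conjugated by [c]. *)
Lemma transfer_step w r p q (p' q' : X) (c : {path UI from w to r})
    (d : {path UI from r to p}) (b : {path UI from p to p'})
    (a : {path UI from q to q'}) (f : {path UI from w to q})
    (mu : {path UI from q to p}) (mu' : {path UI from q' to p'}) g f' g' :
  homotopic f' (f ∗ a) -> homotopic g (c ∗ d) -> homotopic g' (g ∗ b) ->
  homotopic (f' ∗ mu' ∗ path_reverse g') (f ∗ mu ∗ path_reverse g ∗
   (c ∗ (d ∗ path_reverse mu ∗ a ∗ mu' ∗ path_reverse b ∗ path_reverse d) ∗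
    path_reverse c)).
Proof. by move=> -> gE ->; rewrite gE !homotopicE. Qed.

Variable x : X.
Variable L : set (pi1 R x).
Hypothesis L_subgroup : is_subgroup L.
Hypothesis X_lpc : locally_path_connected R X.
Variable h : path_from R x.
Hypothesis h_transfer : forall (c : R) p (hc : h (clamp c) = p),
  exists2 V, open_nbhs p V & path_pi1 (path_prefix hc) V `<=` L.

(** Times are arbitrary reals, clamped, so that connectedness of the whole line applies. Asking for
    every [W] keeps [mu] inside whatever neighbourhood the next step prescribes. *)
Definition transferable (c : R) := forall p (hc : h (clamp c) = p) W,
  open_nbhs p W ->
  nbhs h [set h' : path_from R x | forall q (h'c : h' (clamp c) = q),
    exists2 mu : {path UI from q to p}, range mu `<=` W &
      L (loop_class (path_prefix h'c ∗ mu ∗ path_reverse (path_prefix hc)))].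

Lemma transferable0 : transferable 0.
Proof.
move=> p hc W [_ Wp]; apply: (@filterE _ (nbhs h)) => h' q h'c.
have pE : p = x by rewrite -hc [LHS]path_zero.
have qE : q = x by rewrite -h'c [LHS]path_zero.
move: hc h'c Wp; rewrite pE qE => hc h'c Wx.
exists (path_cst x); first by move=> _ [t _ <-].
by rewrite !path_prefix_zero !homotopicE; exact: is_subgroup1.
Qed.

(** Close to [r], the arcs and both connecting paths stay in one [V] whose loops conjugate into [L],
    so passing from [s] to [s'] changes the comparison loop by a factor in [L]. The symmetry in [s]
    and [s'] serves both openness and closedness. *)
Lemma transferable_near (r : R) : \forall s \near r, \forall s' \near r,
  transferable s -> transferable s'.
Proof.
have [V0 oV0 V0L] := h_transfer (erefl (h (clamp r))).
have [V [[oV Vr] VV0 pcV]] := X_lpc oV0.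
have ch : continuous (fun c : R => h (clamp c)).
  by apply: comp_continuous (path_continuous h); exact: clamp_continuous.
have [e /= e0 eV] : exists2 e : R, 0 < e &
    forall s, r - e <= s <= r + e -> V (h (clamp s)).
  have /nbhs_ballP[e /= e0 eV] : nbhs r [set s | V (h (clamp s))].
    by apply: (ch r); exact: open_nbhs_nbhs.
  (* Half the radius, so that the closed interval, which gives a compact set of times, still maps
     into [V]. *)
  exists (e / 2); first lra.
  move=> s sr; apply: eV => /=; rewrite /ball/= ltr_norml; lra.
have near_itv : \forall s \near r, r - e <= s <= r + e.
  by apply/nbhs_ballP; exists e => //= s; rewrite /ball/= ltr_norml; lra.
have step s s' : r - e <= s <= r + e -> r - e <= s' <= r + e ->
    transferable s -> transferable s'.
  move=> sr s'r ts p' hs' W oW.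
  have [W' [[oW' W'p'] W'W pcW']] : exists W', [/\ open_nbhs p' W',
      W' `<=` W `&` V & path_connected R W'].
    by apply: X_lpc; apply: open_nbhsI => //; split=> //; rewrite -hs'; exact: eV.
  pose hs := erefl (h (clamp s)).
  have oVs : open_nbhs (h (clamp s)) V by split=> //; exact: eV.
  have cI : compact [set clamp c | c in `[r - e, r + e]%classic].
    apply: continuous_compact; last exact: segment_compact.
    by apply: continuous_subspaceT; exact: clamp_continuous.
  have nV : nbhs h [set h' : path_from R x |
      h' @` [set clamp c | c in `[r - e, r + e]%classic] `<=` V].
    apply: near_path_from => // _ [_ [c cI' <-] <-].
    by apply: eV; rewrite /= in_itv/= in cI'.
  have nW' : nbhs h [set h' : path_from R x | h' @` [set clamp s'] `<=` W'].
    apply: near_path_from => //; first exact: compact_set1.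
    by move=> _ [_ -> <-]; rewrite hs'.
  apply: filterS (filterI (filterI nV nW') (ts _ hs V oVs)).
  move=> h' [[h'V h'W'] h'ts] q' h's'.
  pose h's := erefl (h' (clamp s)).
  have [mu muV Lmu] := h'ts _ h's.
  have W'q' : W' q' by apply: h'W'; exists (clamp s').
  have [mu' mu'W'] := pcW' _ _ W'q' W'p'.
  exists mu'; first by move=> y /mu'W'/W'W[].
  (* The loop [l] follows [h] from time [r] to [s], crosses to [h'], follows it to time [s'],
     crosses back and returns along [h], all within [V]. *)
  pose d := path_arc (erefl (h (clamp r))) hs.
  pose l := d ∗ path_reverse mu ∗ path_arc h's h's' ∗ mu' ∗
    path_reverse (path_arc hs hs') ∗ path_reverse d.
  have -> : loop_class (path_prefix h's' ∗ mu' ∗ path_reverse (path_prefix hs')) =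
      (loop_class (path_prefix h's ∗ mu ∗ path_reverse (path_prefix hs)) *
       loop_class (path_prefix (erefl (h (clamp r))) ∗ l ∗
                   path_reverse (path_prefix (erefl (h (clamp r))))))%g.
    rewrite -loop_classM; apply/loop_classP.
    apply: transfer_step; exact: path_prefix_concat.
  apply: (is_subgroupM L_subgroup Lmu); apply: V0L; exists l; last by [].
  have arcV (f : path_from R x) a b p q (fa : f (clamp a) = p) (fb : f (clamp b) = q) :
      f @` [set clamp c | c in `[r - e, r + e]%classic] `<=` V ->
      r - e <= a <= r + e -> r - e <= b <= r + e ->
      range (path_arc fa fb) `<=` V.
    move=> fV ar br; apply: (subset_trans (range_path_arc ar br)).
    move=> _ [c cI' <-]; apply: fV; exists (clamp c) => //; exists c => //=.
  have hV : h @` [set clamp c | c in `[r - e, r + e]%classic] `<=` V.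
    by have := nbhs_singleton nV.
  have dV : range d `<=` V by apply: arcV => //; lra.
  apply: subset_trans VV0.
  have muV' : range mu' `<=` V by move=> y /mu'W'/W'W[].
  have aV : range (path_arc h's h's') `<=` V by exact: arcV.
  have bV : range (path_arc hs hs') `<=` V by exact: arcV.
  by do !apply: range_path_concat => //; apply: range_path_reverse.
by near=> s; near=> s' => ?; apply: (step s) => //; [near: s|near: s'].
Unshelve. all: by end_near.
Qed.

Lemma transferable1 : transferable 1.
Proof.
pose A := [set c : R | transferable c].
suff AT : A = setT by change (A 1); rewrite AT.
have cT : connected [set: R] by apply/connected_intervalP.
apply: cT.
- by exists 0; exact: transferable0.
- exists A; last by rewrite setTI.
  (* Openness: [s] is specialized to [c]. *)
  rewrite openE => c Ac; have := transferable_near c => /nbhs_singleton.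
  by apply: filterS => s; exact.
- exists A; last by rewrite setTI.
  rewrite -openC openE => c nAc.
  (* Closedness: here [s'] is specialized to [c]. *)
  have := transferable_near c; apply: filterS => s /nbhs_singleton sc As.
  exact/nAc/sc.
Qed.

Lemma near_transfer W : open_nbhs (path_end h) W ->
  nbhs h [set h' : path_from R x |
    exists2 mu : {path UI from path_end h' to path_end h}, range mu `<=` W &
      L (loop_class (h' ∗ mu ∗ path_reverse h))].
Proof.
move=> oW; have h1 : h (clamp 1) = path_end h by exact: path_one.
apply: filterS (transferable1 h1 oW) => h' /(_ _ (@path_one _ _ _ _ h')) [mu muW].
by rewrite !path_prefix_one; exists mu.
Qed.

End transfer.

(** * Closedness in the two topologies *)

Section closed_subgroups.
Context {R : realType} {X : topologicalType} {x : X}.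
Local Notation UI := (unit_interval R).
Implicit Types K : set (pi1 R x).

Lemma closed_qtop_wh K :
  closed (K : set (pi1_qtop R x)) -> closed (K : set (pi1_wh R x)).
Proof.
rewrite -!openC => -[B oB BK]; exists B => //.
exact: open_quotient_whisker.
Qed.

(** A basic whisker set that contains [a] and misses [K] can be recentred at [a], where it contains
    all products [a * u]. *)
Lemma closed_wh_separated K (a : pi1 R x) :
  closed (K : set (pi1_wh R x)) -> ~ K a ->
  exists2 U, open_nbhs x U &
    forall u, @pi1_image R X x U u -> ~ K (a * u)%g.
Proof.
rewrite -openC => -[B [D' D'index DB] BK] nKa.
have : B (pi1_incl a) by change ((pi1_incl @^-1` B) a); rewrite BK.
rewrite -DB => -[[f U] D'fU fUa]; have [oU fU] := D'index _ D'fU.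
exists U; first by split=> //; exact: whisker_nbhd_end fUa.
move=> _ [d dU <-]; suff : (~` K) (a * loop_class d)%g by [].
rewrite -BK /= -DB; exists (f, U) => //=.
have /= := whisker_nbhd_sub (@subset_refl _ U) fUa; apply.
exists (PathFrom d) => //.
by rewrite [X in (X * _)%g](loop_class_surj a) -loop_classM pi1_inclE.
Qed.

Lemma is_subgroup_pi1_image V : V x -> is_subgroup (@pi1_image R X x V).
Proof.
move=> Vx; split; first by apply/mem_set; exists (path_cst x) => // _ [t _ <-].
move=> _ _ /set_mem[f fV <-] /set_mem[g gV <-]; apply/mem_set.
exists (f ∗ path_reverse g); last by rewrite loop_classM loop_classV.
by apply: range_path_concat => //; exact: range_path_reverse.
Qed.

(** Local quasinormality enters as an inclusion at the base point, the form that makes [L] a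
    subgroup. *)
Lemma closed_wh_qtop K : locally_path_connected R X ->
  is_subgroup K -> SLT_at K ->
  (forall U, open_nbhs x U -> exists V, [/\ open_nbhs x V, V `<=` U &
    pi1_setmul (@pi1_image R X x V) K `<=` pi1_setmul K (@pi1_image R X x V)]) ->
  closed (K : set (pi1_wh R x)) -> closed (K : set (pi1_qtop R x)).
Proof.
move=> lpc Ksub Kslt Kqn Kwh; rewrite -openC openE => a nKa.
have [U oU aUK] := closed_wh_separated Kwh nKa.
have [V [oV VU VK]] := Kqn U oU; have [_ Vx] := oV.
have Vsub := is_subgroup_pi1_image Vx.
pose L := pi1_setmul K (@pi1_image R X x V).
have Lsub : is_subgroup L by exact: is_subgroup_setmul.
have KL : K `<=` L.
  by move=> k Kk; exists k => //; exists 1%g; [exact: is_subgroup1|exact: mulg1].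
have VL : @pi1_image R X x V `<=` L.
  by move=> v Vv; exists 1%g; [exact: is_subgroup1|exists v => //; exact: mul1g].
(* From [a = k * v], the product [a * v^-1 = k] would lie in [K], against the choice of [U]. *)
have nLa : ~ L a.
  move=> [k Kk [v Vv kva]]; apply: (aUK v^-1)%g.
    case: (is_subgroupV Vsub Vv) => d dV <-; exists d => //.
    exact: subset_trans VU.
  by rewrite -kva mulgK.
pose bad (f : path_from R x) :=
  exists2 l : {path UI from path_end f to x}, range l `<=` V & L (loop_class (f ∗ l)).
pose W : set (path_classes R x) :=
  [set c | exists2 f, c = path_class f & V (path_end f) /\ ~ bad f].
(* The condition depends only on the class; the endpoints are identified first, since the type of
   [l] mentions them. *)
have badP (f g : path_from R x) : path_homotopic f g -> V (path_end f) /\ ~ bad f ->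
    V (path_end g) /\ ~ bad g.
  move: f g => [y f] [z g] fg; have := path_homotopic_one fg; rewrite !path_one /= => yz.
  subst z; have {}fg : homotopic f g by [].
  move=> [Vy nf]; split=> // -[l lV Ll]; apply: nf; exists l => //=.
  by rewrite fg.
have WE (f : path_from R x) : W (path_class f) <-> V (path_end f) /\ ~ bad f.
  by split=> [[g /path_classP/path_homotopic_sym fg]|]; [exact: badP|exists f].
have oW : open (@path_class R X x @^-1` W).
  rewrite openE => h /WE[Vh nh].
  have : nbhs h [set h' : path_from R x |
    exists2 mu : {path UI from path_end h' to path_end h}, range mu `<=` V &
      L (loop_class (h' ∗ mu ∗ path_reverse h))].
    apply: near_transfer => //; last by split=> //; case: oV.
    by move=> c p hc; have [V' oV' V'L] := Kslt _ (path_prefix hc) _ oV; exists V'.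
  apply: filterS => h' [mu muV Lmu]; apply/WE; split.
    by apply: muV; exists zero => //; rewrite path_zero.
  (* If [l] made [h'] bad, [path_reverse mu ∗ l] would make [h] bad: the two loop classes differ by
     a factor in [L]. *)
  move=> [l lV Ll]; apply: nh; exists (path_reverse mu ∗ l).
    by apply: range_path_concat => //; exact: range_path_reverse.
  have -> : loop_class (h ∗ (path_reverse mu ∗ l)) =
      ((loop_class (h' ∗ mu ∗ path_reverse h))^-1 * loop_class (h' ∗ l))%g.
    rewrite -loop_classV -loop_classM; apply/loop_classP.
    change (homotopic (h ∗ (path_reverse mu ∗ l))
      (path_reverse (h' ∗ mu ∗ path_reverse h) ∗ (h' ∗ l))).
    by rewrite !homotopicE.
  by apply: (is_subgroupM Lsub _ Ll); exact: is_subgroupV.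
exists (pi1_incl @^-1` W); split; first by exists W.
  (* A loop [l] in [V] has its class in [L], so [a * loop_class l] in [L] would put [a] in [L]. *)
  apply/WE; split=> //= -[l lV Ll]; apply: nLa.
  rewrite loop_classM -loop_class_surj in Ll.
  rewrite -(mulgK (loop_class l) a); apply: is_subgroupM => //.
  by apply: is_subgroupV => //; apply: VL; exists l.
(* Elements of [K] are bad through the constant path, as [K] lies in [L]. *)
move=> b /WE[_ nb] Kb; apply: nb; exists (path_cst x); first by move=> _ [t _ <-].
by rewrite homotopicp1 -loop_class_surj; exact: KL.
Qed.

End closed_subgroups.

(** * Conjugating a subgroup along [alpha] *)

Section transported_subgroups.
Context {R : realType} {X : topologicalType} {x0 x : X}.
Local Notation UI := (unit_interval R).
Variables (H : set (pi1 R x0)) (alpha : {path UI from x0 to x}).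
Local Notation K := (transport H alpha).

(** Conjugation by [alpha] is invertible, which turns the existential in [transport] into a test on
    one loop. *)
Lemma transportE (f : loop R x) :
  K (loop_class f) <-> H (loop_class (alpha ∗ f ∗ path_reverse alpha)).
Proof.
split=> [[d Hd /loop_classP df]|Hf].
  have {}df : homotopic (path_reverse alpha ∗ d ∗ alpha) f by [].
  by rewrite -df !homotopicE.
exists (alpha ∗ f ∗ path_reverse alpha) => //.
by rewrite !homotopicE.
Qed.

Lemma is_subgroup_transport : is_subgroup H -> is_subgroup K.
Proof.
move=> HH; split.
  apply/mem_set/transportE; rewrite !homotopicE; exact: is_subgroup1.
move=> a b /set_mem + /set_mem; rewrite (loop_class_surj a) (loop_class_surj b).
move: (repr a) (repr b) => f g /transportE Hf /transportE Hg; apply/mem_set.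
rewrite -loop_classV -loop_classM; apply/transportE.
have := is_subgroupM HH Hf (is_subgroupV HH Hg).
by rewrite -loop_classV -loop_classM !homotopicE.
Qed.

(** Conjugation along [alpha] carries [path_pi1 alpha V] to the image of loops in [V] and [H] to
    [K], hence also the inclusion of products. *)
Lemma transport_image_permute V :
  pi1_setmul (path_pi1 alpha V) H `<=` pi1_setmul H (path_pi1 alpha V) ->
  pi1_setmul (@pi1_image R X x V) K `<=` pi1_setmul K (@pi1_image R X x V).
Proof.
move=> VH _ [_ [e eV <-] [_ [d Hd <-] <-]].
have : pi1_setmul H (path_pi1 alpha V)
    (loop_class (alpha ∗ e ∗ path_reverse alpha) * loop_class d)%g.
  by apply: VH; exists (loop_class (alpha ∗ e ∗ path_reverse alpha));
    [exists e|exists (loop_class d)].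
move=> [c Hc [_ [e' e'V <-]]]; rewrite (loop_class_surj c) in Hc *.
move: (repr c) Hc => {}c Hc; rewrite -!loop_classM => /loop_classP ce.
have {}ce : homotopic (path_reverse alpha ∗ c ∗ alpha ∗ e')
    (e ∗ (path_reverse alpha ∗ d ∗ alpha)).
  have {}ce : homotopic (c ∗ (alpha ∗ e' ∗ path_reverse alpha))
    (alpha ∗ e ∗ path_reverse alpha ∗ d) by [].
  have : homotopic (path_reverse alpha ∗ (c ∗ (alpha ∗ e' ∗ path_reverse alpha)) ∗ alpha)
    (path_reverse alpha ∗ (alpha ∗ e ∗ path_reverse alpha ∗ d) ∗ alpha).
    by rewrite ce.
  by rewrite !homotopicE.
exists (loop_class (path_reverse alpha ∗ c ∗ alpha)); first by exists c.
by exists (loop_class e'); [exists e'|rewrite -loop_classM ce].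
Qed.

End transported_subgroups.

Theorem corollary3p8 (R : realType) (X : topologicalType)
    (X_connected : path_connected R [set: X])
    (X_locally_connected : locally_path_connected R X)
    (x0 : X) (H : set (pi1 R x0)) (H_subgroup : is_subgroup H)
    (X_SLT : SLT_space H) (H_quasinormal : locally_quasinormal H)
    (x : X) (alpha : {path (unit_interval R) from x0 to x}) :
  closed (transport H alpha : set (pi1_qtop R x)) <->
  closed (transport H alpha : set (pi1_wh R x)).
Proof.
split; first exact: closed_qtop_wh.
apply: closed_wh_qtop => //; first exact: is_subgroup_transport.
(* Local quasinormality is applied to [alpha] itself, which ends at [x]. *)
move=> U oU; have [V [oV VU HV]] := H_quasinormal x alpha U oU.
by exists V; split=> //; apply: transport_image_permute; rewrite HV.
Qed.
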